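(* Let $0<q<1$, let $\mathbf{a}=(a_1,\dots,a_t)$ and $\mathbf{b}=(b_1,\dots,b_s)$ be vectors of nonnegative real numbers, and set $\mathbf{c}=(q^{-a_1}-1,\dots,q^{-a_t}-1)$, $\mathbf{d}=(q^{-b_1}-1,\dots,q^{-b_s}-1)$. Let $g(\mu;x)$, $\Delta_g(\alpha,\beta;x)$ and its power series coefficients $\gamma_m$ (in powers of $x$) be as defined in the context, where $\mu\ge 0$ (and $\mu>0$ if some $a_i$ or $b_j$ equals $0$), and $x$ lies in the domain of convergence. In (a) and (b) the stated inequalities between ratios include the requirement that no denominator vanishes. (a) Suppose $s\le t\le s+1$ and $$\frac{e_t(\mathbf{c})}{e_s(\mathbf{d})}\leq \frac{e_{t-1}(\mathbf{c})}{e_{s-1}(\mathbf{d})}\leq \dots \leq \frac{e_{t-s+1}(\mathbf{c})}{e_1(\mathbf{d})}\leq e_{t-s}(\mathbf{c}).$$ Then $\Delta_g(\alpha,\beta;x)\le 0$ for $x\ge 0$ (in the domain of convergence), $\beta\ge 0$ and $\alpha\in\mathbb{N}$. Moreover, if $\alpha\le\beta+1$, then all power series coefficients $\gamma_m$ of $x\mapsto\Delta_g(\alpha,\beta;x)$ are non-positive. In particular, $g(\mu+1;x)^2\le g(\mu;x)\,g(\mu+2;x)$ for every such $\mu$ and fixed $x>0$ in the domain of convergence. (b) Suppose $t\le s$ and $$\frac{e_s(\mathbf{d})}{e_t(\mathbf{c})}\leq \frac{e_{s-1}(\mathbf{d})}{e_{t-1}(\mathbf{c})}\leq\cdots\leq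 \frac{e_{s-t+1}(\mathbf{d})}{e_1(\mathbf{c})}\leq e_{s-t}(\mathbf{d}).$$ Then $\Delta_g(\alpha,\beta;x)\ge 0$ for $x\ge 0$, $\beta\ge 0$ and $\alpha\in\mathbb{N}$. Moreover, if $\alpha\le\beta+1$, then all power series coefficients $\gamma_m$ of $x\mapsto\Delta_g(\alpha,\beta;x)$ are non-negative. In particular, $g(\mu+1;x)^2\ge g(\mu;x)\,g(\mu+2;x)$ for every such $\mu$ and any fixed $x>0$.
   Context: Throughout $0<q<1$ is fixed and $\mathbb{N}=\{1,2,\dots\}$. The $q$-shifted factorial is $(a;q)_0=1$, $(a;q)_n=\prod_{k=0}^{n-1}(1-aq^k)$ for $n\in\mathbb{N}$, and $(a;q)_\infty=\lim_{n\to\infty}(a;q)_n$. The $q$-gamma function is $\Gamma_q(z)=(1-q)^{1-z}\frac{(q;q)_\infty}{(q^z;q)_\infty}$. For vectors $\mathbf{a}=(a_1,\dots,a_t)$, $\mathbf{b}=(b_1,\dots,b_s)$ and a scalar $\mu$, $\mathbf{a}+\mu=(a_1+\mu,\dots,a_t+\mu)$ and $\Gamma_q(\mathbf{a})=\Gamma_q(a_1)\cdots\Gamma_q(a_t)$ (similarly for $\mathbf{b}$; empty products equal $1$). Put $p=1+s-t\ge 0$ and define $$g(\mu;x)=\frac{\Gamma_q(\mathbf{a}+\mu)}{\Gamma_q(\mathbf{b}+\mu)}\sum_{n=0}^{\infty}\frac{\prod_{i=1}^t(q^{a_i+\mu};q)_n}{\prod_{j=1}^s(q^{b_j+\mu};q)_n\,(q;q)_n}\left[(-1)^nq^{\binom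 n2}\right]^{p}\left((q-1)^{p}x\right)^n,$$ i.e. $g(\mu;x)=\frac{\Gamma_q(\mathbf{a}+\mu)}{\Gamma_q(\mathbf{b}+\mu)}\,{}_t\phi_s(q^{\mathbf{a}+\mu};q^{\mathbf{b}+\mu};(q-1)^{1+s-t}x)$ with ${}_t\phi_s$ the generalized $q$-hypergeometric series. The series converges for all $x$ if $t\le s$ and for $|x|<1$ if $t=s+1$. The generalized Turánian and its coefficients are $$\Delta_g(\alpha,\beta;x)=g(\mu+\alpha;x)g(\mu+\beta;x)-g(\mu;x)g(\mu+\alpha+\beta;x)=\sum_{m=0}^\infty\gamma_mx^m.$$ The elementary symmetric polynomials are $e_0(c_1,\dots,c_r)=1$ and $e_k(c_1,\dots,c_r)=\sum_{1\le j_1<\cdots<j_k\le r}c_{j_1}\cdots c_{j_k}$, $k=1,\dots,r$. *)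

(* Defs.v *)
From HB Require Import structures.
From mathcomp Require Import all_boot all_order all_algebra.
From mathcomp Require Import all_classical all_reals all_analysis.
(* Required without Import: the notations of mpoly clash with those of the
   analysis library. *)
From mathcomp Require mpoly.

Set Implicit Arguments.
Unset Strict Implicit.
Unset Printing Implicit Defensive.

Import Order.TTheory GRing.Theory Num.Theory.
Import numFieldNormedType.Exports.

Local Open Scope classical_set_scope.
Local Open Scope ring_scope.

Section QSeries.
Context {R : realType}.
Implicit Types (q x z mu : R) (n k t s : nat).

Definition qpoch (u q : R) n : R := \prod_(0 <= k < n) (1 - u * q ^+ k).

Definition qpoch_inf (u q : R) : R := limn (qpoch u q).

Definition qGamma q z : R :=
  (1 - q) `^ (1 - z) * (qpoch_inf q q / qpoch_inf (q `^ z) q).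

(* Only used for t <= s + 1, so that the subtraction (1 + s - t)%N is exact. *)
Definition qhyp_coef q t s (u : 'I_t -> R) (v : 'I_s -> R) n : R :=
  (\prod_(i < t) qpoch (u i) q n)
    / ((\prod_(j < s) qpoch (v j) q n) * qpoch q q n)
  * ((-1) ^+ n * q ^+ 'C(n, 2)) ^+ (1 + s - t).

Definition qhyp q t s (u : 'I_t -> R) (v : 'I_s -> R) z : R :=
  limn (pseries (qhyp_coef q u v) z).

Definition gfun q t s (a : 'I_t -> R) (b : 'I_s -> R) mu x : R :=
  (\prod_(i < t) qGamma q (a i + mu)) / (\prod_(j < s) qGamma q (b j + mu))
  * qhyp q (fun i => q `^ (a i + mu)) (fun j => q `^ (b j + mu))
      ((q - 1) ^+ (1 + s - t) * x).

Definition conv_domain t s : set R := [set x | (t <= s)%N \/ `|x| < 1].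

Definition turanian q t s (a : 'I_t -> R) (b : 'I_s -> R) mu
    (alpha beta : R) x : R :=
  gfun q a b (mu + alpha) x * gfun q a b (mu + beta) x
  - gfun q a b mu x * gfun q a b (mu + alpha + beta) x.

Definition expands_on (D : set R) (f : R -> R) (gamma : nat -> R) : Prop :=
  forall x, D x -> pseries gamma x @ \oo --> f x.

Definition esym r (c : 'I_r -> R) k : R := mpoly.meval c (mpoly.mesym r R k).

Lemma esymE r (c : 'I_r -> R) k :
  esym c k = \sum_(A : {set 'I_r} | #|A| == k) \prod_(i in A) c i.
Proof.
rewrite /esym /mpoly.mesym.
rewrite (big_morph _ (mpoly.mevalD c) (mpoly.meval0 c)).
apply: eq_bigr => A _.
rewrite (big_morph _ (mpoly.mevalM c) (mpoly.meval1 c)).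
by apply: eq_bigr => i _; rewrite mpoly.mevalXU.
Qed.

Definition qshift q r (a : 'I_r -> R) : 'I_r -> R :=
  fun i => q `^ (- a i) - 1.

(* For s <= t, the chain
     e_t(c)/e_s(d) <= e_(t-1)(c)/e_(s-1)(d) <= ...
       <= e_(t-s+1)(c)/e_1(d) <= e_(t-s)(c)
   with nonzero denominators; its last term is the ratio of index k = 0,
   since e_0(d) = 1. *)
Definition ratio_chain t s (c : 'I_t -> R) (d : 'I_s -> R) : Prop :=
  (forall k, (1 <= k <= s)%N -> esym d k != 0) /\
  (forall k, (k < s)%N ->
     esym c (t - s + k.+1) / esym d k.+1 <= esym c (t - s + k) / esym d k).

End QSeries.

(* Main.v *)
(* Write g(v; x) = sum_n f(v + n) h_n x^n with
   f(v) = prod Gamma_q(a_i + v) / prod Gamma_q(b_j + v) and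
   h_n = q^(p n (n - 1) / 2) (1 - q)^n / (q; q)_n, p = 1 + s - t >= 0.

   Since 1 - q^(a + v) = q^a (c + y) with c = q^(-a) - 1 and y = 1 - q^v, the
   ratio f(v + 1) / f(v) is a constant times prod (c_i + y) / prod (d_j + y).
   The chain of inequalities says that the ratios of the coefficients of these
   two polynomials in y are monotone, hence so is their quotient.  This gives
   the sign eps of f(v + n) f(v + beta) - f(v) f(v + n + beta) for all natural n.

   The coefficient gamma_m is the sum over k <= m of h_k h_(m-k) M_k, where
   M_k = f(mu + alpha + k) f(mu + beta + m - k)
         - f(mu + k) f(mu + alpha + beta + m - k).
   The weights h_k h_(m-k) increase towards k = m / 2 because h is log-concave,
   so by Abel summation only the sums of M_k over K <= k <= m - K matter.  These
   telescope to alpha differences of the above kind, which all have sign eps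
   when alpha <= beta + 1.  With alpha = 1 this gives the sign of
   g(v + 1) g(v + beta) - g(v) g(v + 1 + beta) for every v >= mu, and an
   arbitrary natural alpha follows by induction. *)

Require Import Defs.
From mathcomp Require Import all_boot all_order all_algebra.
From mathcomp Require Import all_classical all_reals all_analysis.
From mathcomp Require Import ring lra zify.

Import Order.TTheory GRing.Theory Num.Theory.
Import numFieldNormedType.Exports.

Local Open Scope classical_set_scope.
Local Open Scope ring_scope.

(** * Signs of convolution sums *)

(** Abel summation done as an induction on [m] in steps of two. Subtracting the constant weight
    [w 0] splits off a multiple of the full sum and kills both end terms. What is left is the same
    problem on the inner interval, with weights [w k.+1 - w 0]. *)
Lemma sum_centered_weights_ge0 (R : realDomainType) (m : nat) (w M : nat -> R) :
  0 <= w 0%N ->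
  (forall k, (k <= m)%N -> w (m - k)%N = w k) ->
  (forall k, (k.+1.*2 <= m)%N -> w k <= w k.+1) ->
  (forall K, (K.*2 <= m)%N -> 0 <= \sum_(K <= k < m.+1 - K) M k) ->
  0 <= \sum_(0 <= k < m.+1) w k * M k.
Proof.
elim/ltn_ind: m w M => [[|[|m]]] IH w M w0 wsym winc Mge0.
- by rewrite big_nat1 mulr_ge0//; have := Mge0 0%N isT; rewrite big_nat1.
- have w1 : w 1%N = w 0%N by rewrite -(wsym 0%N).
  have := Mge0 0%N isT.
  rewrite subn0 !big_nat_recr//= !big_geq// !add0r w1 -mulrDr => ?.
  exact: mulr_ge0.
- have -> : \sum_(0 <= k < m.+3) w k * M k =
    w 0%N * \sum_(0 <= k < m.+3) M k +
    \sum_(0 <= k < m.+3) (w k - w 0%N) * M k.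
    by rewrite mulr_sumr -big_split; apply: eq_bigr => k _ /=; ring.
  rewrite addr_ge0//; first by rewrite mulr_ge0//; have := Mge0 0%N isT.
  have wl : w m.+2 = w 0%N by rewrite -(wsym 0%N).
  rewrite big_nat_recr//= big_nat_recl//= wl !subrr !mul0r add0r addr0.
  apply: (IH m _ (fun k => w k.+1 - w 0%N) (fun k => M k.+1)) => //.
  + by rewrite subr_ge0 winc.
  + by move=> k km; congr (_ - _); rewrite -[RHS]wsym; last lia; congr w; lia.
  + by move=> k km; rewrite lerD2r winc.
  + move=> K Km; have := Mge0 K.+1; rewrite doubleS !ltnS => /(_ Km).
    by rewrite subSS subSn 1?big_add1//=; lia.
Qed.

(** Both sides equal the sum of [u] over indices below [n + p] minus its sums below [n] and below
    [p], an expression symmetric in [n] and [p]. It trades a sum of [m.+1] differences for one of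
    [alpha] differences. *)
Lemma sumB_shift (V : zmodType) (u : nat -> V) (n p : nat) :
  \sum_(0 <= k < n) (u (k + p)%N - u k) = \sum_(0 <= j < p) (u (n + j)%N - u j).
Proof.
have split_sum k l : \sum_(0 <= i < l) u (i + k)%N =
    \sum_(0 <= i < k + l) u i - \sum_(0 <= i < k) u i.
  rewrite (big_cat_nat (n := k) (p := k + l)) ?leq_addr//= addrAC subrr add0r.
  by rewrite -{2}(add0n k) big_addn addnC addnK.
rewrite !sumrB split_sum; under [X in _ = X - _]eq_bigr do rewrite addnC.
by rewrite split_sum addnC addrAC.
Qed.

Section TuranSign.
Context {R : realFieldType}.
Variables (eps : R) (f : R -> R) (mu : R).

(** Induction on the shift: multiplied by the positive f(v + n + beta), the inequality for n + 1 is
    a positive combination of the one-step inequality at v + n and the induction hypothesis at v. It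
    serves twice, for the gamma ratios and for g at fixed [x]. *)
Lemma turan_shift_nat :
  (forall v, mu <= v -> 0 < f v) ->
  (forall v beta, mu <= v -> 0 <= beta ->
    0 <= eps * (f (v + 1) * f (v + beta) - f v * f (v + 1 + beta))) ->
  forall (n : nat) v beta, mu <= v -> 0 <= beta ->
    0 <= eps * (f (v + n%:R) * f (v + beta) - f v * f (v + n%:R + beta)).
Proof.
move=> f_gt0 step n v beta muv beta0; elim: n => [|n IH].
  by rewrite addr0 subrr mulr0.
have n0 : 0 <= n%:R :> R by exact: ler0n.
have muvn : mu <= v + n%:R by rewrite ler_wpDr.
have := step (v + n%:R) beta muvn beta0; rewrite -natr1 !addrA => Sn.
have pos1 : 0 < f (v + n%:R + beta) by apply: f_gt0; lra.
have pos2 : 0 < f (v + n%:R + 1 + beta) by apply: f_gt0; lra.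
have pos3 : 0 < f (v + beta) by apply: f_gt0; lra.
rewrite -(pmulr_rge0 _ pos1).
set t := (X in 0 <= X).
have -> : t = f (v + beta) * (eps * (f (v + n%:R + 1) * f (v + n%:R + beta)
    - f (v + n%:R) * f (v + n%:R + 1 + beta)))
  + f (v + n%:R + 1 + beta) * (eps * (f (v + n%:R) * f (v + beta)
    - f v * f (v + n%:R + beta))) by rewrite /t; ring.
by rewrite addr_ge0// mulr_ge0// ltW.
Qed.

Hypothesis turan_nat : forall (n : nat) v beta, mu <= v -> 0 <= beta ->
  0 <= eps * (f (v + n%:R) * f (v + beta) - f v * f (v + n%:R + beta)).

(** With u(k) = f(v + k) f(v + alpha + beta + m - k) the summand is u(k + alpha) - u(k), so the sum
    collapses to the differences u(m + 1 + j) - u(j) for j < alpha. *)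
Lemma turan_sum_ge0 (m alpha : nat) v beta :
  mu <= v -> 0 <= beta -> alpha%:R <= beta + 1 ->
  0 <= eps * \sum_(0 <= k < m.+1)
    (f (v + alpha%:R + k%:R) * f (v + beta + (m - k)%:R)
     - f (v + k%:R) * f (v + alpha%:R + beta + (m - k)%:R)).
Proof.
move=> muv beta0 alpha_le.
pose u k := f (v + k%:R) * f (v + alpha%:R + beta + m%:R - k%:R).
rewrite (_ : \sum_(_ <= _ < _) _ = \sum_(0 <= j < alpha) (u (m.+1 + j)%N - u j)).
  rewrite mulr_sumr big_nat sumr_ge0// => j /andP[_ jalpha].
  have ja : j.+1%:R <= alpha%:R :> R by rewrite ler_nat.
  rewrite -natr1 in ja.
  have j0 : 0 <= j%:R :> R by exact: ler0n.
  (* Based at v + j with shift m + 1, the remaining parameter is alpha + beta - 1 - 2j. As j <=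
     alpha - 1, it is at least beta + 1 - alpha, which is where the bound on alpha enters. *)
  have := turan_nat m.+1 (v + j%:R) (alpha%:R + beta - 1 - j%:R *+ 2).
  rewrite /u natrD -natr1 mulr2n => /(_ _ _)/le_trans; apply; [lra|lra|].
  by rewrite le_eqVlt; apply/orP; left; apply/eqP; congr (_ * (f _ * f _ - f _ * f _));
    ring.
rewrite -sumB_shift !big_nat; apply: eq_bigr => k /andP[_ km].
by rewrite /u natrB// natrD; congr (f _ * f _ - f _ * f _); ring.
Qed.

(* The central sum over [K <= k <= m - K] is the full sum of [turan_sum_ge0]
   with [mu] replaced by [mu + K] and [m] by [m - 2 K]. *)
Lemma turan_coef_ge0 (h : nat -> R) (m alpha : nat) beta :
  (forall n, 0 <= h n) ->
  (forall i j, (i <= j)%N -> h i * h j.+1 <= h i.+1 * h j) ->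
  0 <= beta -> alpha%:R <= beta + 1 ->
  0 <= eps * \sum_(0 <= k < m.+1)
    ((f (mu + alpha%:R + k%:R) * h k) * (f (mu + beta + (m - k)%:R) * h (m - k)%N)
     - (f (mu + k%:R) * h k)
       * (f (mu + alpha%:R + beta + (m - k)%:R) * h (m - k)%N)).
Proof.
move=> h_ge0 h_lc beta0 alpha_le.
pose M k := eps * (f (mu + alpha%:R + k%:R) * f (mu + beta + (m - k)%:R)
     - f (mu + k%:R) * f (mu + alpha%:R + beta + (m - k)%:R)).
rewrite mulr_sumr (eq_bigr (fun k => (h k * h (m - k)%N) * M k)); last first.
  by move=> k _; rewrite /M; ring.
apply: sum_centered_weights_ge0.
- exact: mulr_ge0.
- by move=> k km; rewrite subKn// mulrC.
- move=> k km; have -> : (m - k = (m - k.+1).+1)%N by lia.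
  by apply: h_lc; lia.
- move=> K Km; rewrite -mulr_sumr.
  have K0 : 0 <= K%:R :> R by exact: ler0n.
  have := turan_sum_ge0 (m - K.*2) alpha (mu + K%:R) beta.
  move=> /(_ _ beta0 alpha_le)/le_trans; apply; first lra.
  rewrite -{8}(add0n K) big_addn (_ : (m.+1 - K - K)%N = (m - K.*2).+1); last lia.
  rewrite le_eqVlt; apply/orP; left; apply/eqP; congr (_ * _).
  rewrite !big_nat; apply: eq_bigr => k /andP[_ km].
  have -> : (m - (k + K) = K + (m - K.*2 - k))%N by lia.
  by rewrite !natrD; congr (f _ * f _ - f _ * f _); ring.
Qed.

End TuranSign.

(** * Power series *)

Section PowerSeries.
Context {R : realType}.
Implicit Types (a b : nat -> R) (x : R).

Definition cauchy_prod a b n : R := \sum_(0 <= k < n.+1) a k * b (n - k)%N.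

Lemma cauchy_prod_partial a b N :
  series (cauchy_prod a b) N = \sum_(0 <= k < N) a k * series b (N - k)%N.
Proof.
rewrite /series /=; elim: N => [|N IH]; first by rewrite !big_geq.
rewrite big_nat_recr//= IH /cauchy_prod !big_nat_recr//= subnn subSnn big_nat1.
rewrite addrA; congr (_ + _); rewrite -big_split !big_nat.
apply: eq_bigr => k /andP[_ kN] /=; rewrite -mulrDr subSn 1?ltnW//.
by rewrite big_nat_recr.
Qed.

(** The triangle k + l < n lies in the square k, l < n, which lies in the triangle of size 2n. For
    nonnegative terms this squeezes the partial sums of the Cauchy product between products of
    partial sums. *)
Lemma cauchy_prod_ge0_cvg a b (A B : R) :
  (forall n, 0 <= a n) -> (forall n, 0 <= b n) ->
  series a @ \oo --> A -> series b @ \oo --> B ->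
  series (cauchy_prod a b) @ \oo --> A * B.
Proof.
move=> a0 b0 aA bB.
have c0 n : 0 <= cauchy_prod a b n by apply: sumr_ge0 => k _; rewrite mulr_ge0.
have sa_ge0 n : 0 <= series a n by rewrite sumr_ge0.
have sb_ge0 n : 0 <= series b n by rewrite sumr_ge0.
have sa_nd : nondecreasing_seq (series a) by apply: nondecreasing_series.
have sb_nd : nondecreasing_seq (series b) by apply: nondecreasing_series.
have sc_nd : nondecreasing_seq (series (cauchy_prod a b)).
  by apply: nondecreasing_series.
have sab : (fun n => series a n * series b n) @ \oo --> A * B by exact: cvgM aA bB.
have le_prod n : series (cauchy_prod a b) n <= series a n * series b n.
  rewrite cauchy_prod_partial mulr_suml ler_sum// => k _.
  by rewrite ler_wpM2l// sb_nd// leq_subr.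
have prod_le n : series a n * series b n <= series (cauchy_prod a b) (n + n)%N.
  rewrite cauchy_prod_partial mulr_suml.
  rewrite (big_cat_nat (n := n) (p := n + n)) ?leq_addr//=.
  apply: ler_wpDr; first by apply: sumr_ge0 => k _; rewrite mulr_ge0.
  rewrite !big_nat ler_sum// => k /andP[_ kn].
  by rewrite ler_wpM2l// sb_nd//; lia.
have prod_nd : nondecreasing_seq (fun n => series a n * series b n).
  by move=> m n mn; rewrite ler_pM ?sa_nd ?sb_nd.
have ub n : series (cauchy_prod a b) n <= A * B.
  rewrite (le_trans (le_prod n))// -(cvg_lim _ sab)//.
  by apply: nondecreasing_cvgn_le => //; apply/cvg_ex; exists (A * B).
have cc : cvgn (series (cauchy_prod a b)).
  by apply: nondecreasing_is_cvgn => //; exists (A * B) => _ [n _ <-].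
suff <- : limn (series (cauchy_prod a b)) = A * B by [].
apply/eqP; rewrite eq_le limr_le//=; last exact: nearW.
apply: (cvgr_to_le sab); apply: nearW => n.
by rewrite (le_trans (prod_le n))// nondecreasing_cvgn_le.
Qed.

(** The error against the product of partial sums is the sum over the square minus the triangle. It
    is dominated by the same error [E] for absolute values, which vanishes by the nonnegative
    case. *)
Lemma cauchy_prod_cvg a b :
  cvgn [normed series a] -> cvgn [normed series b] ->
  series (cauchy_prod a b) @ \oo --> limn (series a) * limn (series b).
Proof.
move=> na nb.
pose a' n := `|a n|; pose b' n := `|b n|.
have ca := normed_cvg na; have cb := normed_cvg nb.
have cc' : series (cauchy_prod a' b') @ \oo --> limn (series a') * limn (series b').
  apply: cauchy_prod_ge0_cvg => [n|n||]; [exact: normr_ge0|exact: normr_ge0| |].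
    exact: na.
  exact: nb.
pose E n : R := series a' n * series b' n - series (cauchy_prod a' b') n.
have E0 : E @ \oo --> (0 : R).
  rewrite -(subrr (limn (series a') * limn (series b'))).
  by apply: (cvgB _ cc'); exact: cvgM na nb.
pose D n : R := series (cauchy_prod a b) n - series a n * series b n.
have D0 : D @ \oo --> (0 : R).
  apply: norm_cvg0; apply: (squeeze_cvgr _ (cvg_cst 0) E0).
  apply: nearW => n; rewrite normr_ge0 /D /E distrC !cauchy_prod_partial !mulr_suml.
  rewrite -!sumrB (le_trans (ler_norm_sum _ _ _))// ler_sum// => k _.
  rewrite -!mulrBr normrM ler_wpM2l// /series/=.
  rewrite !(big_cat_nat (m := 0) (n := n - k) (p := n)) ?leq_subr//=.
  by rewrite ![_ + _ - _]addrAC !subrr !add0r ler_norm_sum.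
rewrite -[X in _ --> X]add0r.
have -> : series (cauchy_prod a b) = D + (series a \* series b).
  by apply/funext => n; rewrite /D fctE subrK.
by apply: (cvgD D0); exact: cvgM ca cb.
Qed.

Lemma pseries_cauchy_prod a b x : pseries (cauchy_prod a b) x =
  series (cauchy_prod (fun n => a n * x ^+ n) (fun n => b n * x ^+ n)).
Proof.
apply/funext => N; apply: eq_bigr => n _ /=; rewrite /cauchy_prod mulr_suml.
rewrite !big_nat; apply: eq_bigr => k /andP[_ kn].
by rewrite mulrACA -exprD subnKC.
Qed.

Lemma geometric_sum_le2 x n : 0 <= x -> x <= 2^-1 -> \sum_(0 <= j < n) x ^+ j <= 2.
Proof.
move=> x0 x2; elim: n => [|n IH]; first by rewrite big_geq.
rewrite big_nat_recl//= expr0.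
under eq_bigr do rewrite exprS; rewrite -mulr_sumr.
have : x * \sum_(0 <= j < n) x ^+ j <= 2^-1 * 2.
  by rewrite ler_pM// sumr_ge0// => j _; rewrite exprn_ge0.
lra.
Qed.

(** Strong induction on [m]: once the lower coefficients vanish, dividing by x^m leaves |a_m| <= C x
    for all small x > 0, which forces a_m = 0. *)
Lemma pseries_eq0 a :
  (forall x, 0 < x -> x < 1 -> pseries a x @ \oo --> 0) -> forall m, a m = 0.
Proof.
move=> a0; elim/ltn_ind => m IH.
have half1 : 2^-1 < 1 :> R by lra.
have half0 : 0 < 2^-1 :> R by lra.
have [M M0 aM] : exists2 M : R, 0 < M & forall n, `|a n| <= M * 2 ^+ n.
  have cv : cvgn (pseries a (2^-1)) by apply/cvg_ex; exists 0; exact: a0.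
  have /pinfty_ex_gt0[M M0 /= bM] := cvg_series_bounded cv.
  exists M => // n; have /= := bM n I.
  by rewrite normrM normrX (ger0_norm (ltW half0)) exprVn ler_pdivrMr// exprn_gt0.
(* The tail beyond x^m is at most M (2x)^(m+1) times a geometric sum of ratio 2x <= 1/2, hence at
   most 2 M (2x)^(m+1) = C x x^m. *)
pose C := M * 2 ^+ m.+2.
have C0 : 0 < C by rewrite mulr_gt0// exprn_gt0.
have small x : 0 < x -> x <= 4^-1 -> `|a m| <= C * x.
  move=> x0 x4; rewrite -(ler_pM2r (exprn_gt0 m x0)).
  have x1 : x < 1 by lra.
  have lim : (fun N => `|pseries a x N - a m * x ^+ m|) @ \oo --> `|a m| * x ^+ m.
    have -> : `|a m| * x ^+ m = `|0 - a m * x ^+ m|.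
      by rewrite sub0r normrN normrM (ger0_norm (exprn_ge0 m (ltW x0))).
    by apply: cvg_norm; apply: (cvgB (a0 x x0 x1)); exact: cvg_cst.
  apply: (cvgr_to_le lim); exists m.+1 => //= N /= mN.
  rewrite /pseries /series /= (big_cat_nat (n := m)) ?(ltnW mN)//=.
  rewrite big_nat big1 ?add0r; last by move=> i /andP[_ im]; rewrite IH// mul0r.
  rewrite big_ltn// addrAC subrr add0r (le_trans (ler_norm_sum _ _ _))//.
  have -> : C * x * x ^+ m = M * (2 * x) ^+ m.+1 * 2.
    by rewrite /C exprMn !exprS; ring.
  rewrite -(add0n m.+1) big_addn.
  apply: (@le_trans _ _ (M * (2 * x) ^+ m.+1 * \sum_(0 <= j < N - m.+1) (2 * x) ^+ j)).
    rewrite mulr_sumr ler_sum// => j _.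
    rewrite normrM normrX (ger0_norm (ltW x0)) -mulrA -exprD exprMn mulrA addnC.
    by rewrite ler_wpM2r// exprn_ge0// ltW.
  apply: ler_wpM2l; first by rewrite mulr_ge0 ?ltW// exprn_gt0//; lra.
  by apply: geometric_sum_le2; lra.
apply/eqP; rewrite -normr_eq0; apply/eqP/le_anti; rewrite normr_ge0 andbT.
rewrite leNgt; apply/negP => am0.
have D0 : 0 < C * 2 + `|a m| * 4 by lra.
(* This point is at most 1/4, as [small] requires, and makes C x less than |a_m| / 2, a
   contradiction. *)
have := small (`|a m| / (C * 2 + `|a m| * 4)).
rewrite divr_gt0// => /(_ isT).
rewrite ler_pdivrMr// => /(_ _); rewrite mulrA ler_pdivlMr// => H.
have : `|a m| * (C * 2 + `|a m| * 4) <= C * `|a m| by apply: H; lra.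
have : 0 < `|a m| * (C + `|a m| * 4) by rewrite mulr_gt0//; lra.
lra.
Qed.

(** Lets a sign proved for one explicit coefficient sequence pass to every expansion of the same
    function. *)
Lemma expands_on_unique (D : set R) (f : R -> R) a b :
  (forall x, 0 < x -> x < 1 -> D x) ->
  expands_on D f a -> expands_on D f b -> a =1 b.
Proof.
move=> D01 fa fb m; apply/eqP; rewrite -subr_eq0; apply/eqP.
apply: (@pseries_eq0 (fun n => a n - b n)) => x x0 x1.
have -> : pseries (fun n => a n - b n) x = pseries a x - pseries b x.
  apply/funext => n; rewrite fctE /pseries /series /= -sumrB.
  by apply: eq_bigr => k _; rewrite mulrBl.
by rewrite -(subrr (f x)); apply: (cvgB (fa x _) (fb x _)); exact: D01.
Qed.

End PowerSeries.

(** * Elementary symmetric polynomials *)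

(** After symmetrising the double sums, a pair k < l contributes (p_l r_k - p_k r_l) (z^l y^k - y^l
    z^k) to the difference, a product of two nonnegative factors. The cross-multiplied hypothesis
    allows some r_i to be zero. *)
Lemma ratio_mono_of_coefs (R : realDomainType) (N : nat) (p r : nat -> R) (y z : R) :
  (forall i j, (i < j <= N)%N -> p i * r j <= p j * r i) ->
  0 <= y -> y <= z ->
  (\sum_(0 <= i < N.+1) p i * y ^+ i) * (\sum_(0 <= i < N.+1) r i * z ^+ i) <=
  (\sum_(0 <= i < N.+1) p i * z ^+ i) * (\sum_(0 <= i < N.+1) r i * y ^+ i).
Proof.
move=> prle y0 yz.
have z0 : 0 <= z := le_trans y0 yz.
have dbl (X Y : nat -> R) : (\sum_(0 <= i < N.+1) X i) * (\sum_(0 <= i < N.+1) Y i) *+ 2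
   = \sum_(0 <= i < N.+1) \sum_(0 <= j < N.+1) (X i * Y j + X j * Y i).
  rewrite mulr2n; under [RHS]eq_bigr do rewrite big_split.
  rewrite big_split /= [in X in _ = _ + X]exchange_big /=.
  by congr (_ + _); rewrite mulr_suml; apply: eq_bigr => i _; rewrite mulr_sumr.
rewrite -(ler_pMn2r (isT : (0 < 2)%N)) !dbl !big_nat; apply: ler_sum => i /andP[_ iN].
rewrite !big_nat; apply: ler_sum => j /andP[_ jN].
have key k l : (k < l <= N)%N ->
    p k * y ^+ k * (r l * z ^+ l) + p l * y ^+ l * (r k * z ^+ k) <=
    p k * z ^+ k * (r l * y ^+ l) + p l * z ^+ l * (r k * y ^+ k).
  move=> kl; have := prle k l kl; case/andP: kl => kl _.
  have : y ^+ l * z ^+ k <= z ^+ l * y ^+ k.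
    rewrite -(subnK (ltnW kl)) !exprD -!mulrA [z ^+ k * _]mulrC.
    by rewrite ler_wpM2r ?mulr_ge0 ?exprn_ge0// lerXn2r.
  rewrite -subr_ge0 => A; rewrite -subr_ge0 => B; rewrite -subr_ge0.
  by have := mulr_ge0 A B; congr (0 <= _); ring.
case: (ltngtP i j) => [ij|ji|->]; first by apply: key; rewrite ij -ltnS.
  by rewrite addrC [leRHS]addrC; apply: key; rewrite ji -ltnS.
by rewrite le_eqVlt; apply/orP; left; apply/eqP; ring.
Qed.

Section ElementarySymmetric.
Context {R : realType}.

Lemma esym0 (r : nat) (c : 'I_r -> R) : Defs.esym c 0 = 1.
Proof.
rewrite esymE (big_pred1 finset.set0); first by rewrite finset.big_set0.
by move=> A; rewrite cards_eq0.
Qed.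

Lemma esym_ge0 (r : nat) (c : 'I_r -> R) k : (forall i, 0 <= c i) -> 0 <= Defs.esym c k.
Proof. by move=> c0; rewrite esymE sumr_ge0// => A _; rewrite prodr_ge0. Qed.

Lemma prod_add_esym (r : nat) (c : 'I_r -> R) y :
  \prod_(i < r) (c i + y) = \sum_(0 <= k < r.+1) Defs.esym c (r - k) * y ^+ k.
Proof.
rewrite bigA_distr/= big_nat_rev/= big_mkord.
(* The subset [J] collects the factors from which c_i is taken; [inord] is faithful here since #|J|
   <= r. *)
rewrite (partition_big (fun J : {set 'I_r} => inord #|J| : 'I_r.+1) xpredT)//=.
apply: eq_bigr => k _; rewrite add0n subSS esymE.
have kr : (k <= r)%N by rewrite -ltnS.
have Jr (J : {set 'I_r}) : (#|J| < r.+1)%N.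
  by rewrite ltnS -[X in (_ <= X)%N]card_ord max_card.
rewrite subKn// mulr_suml; apply: eq_big => [J|J /eqP Jk].
  by rewrite -val_eqE/= inordK.
rewrite (bigID (fun i => i \in J))/=; congr (_ * _).
  by apply: eq_bigr => i ->.
rewrite (eq_bigr (fun=> y)); last by move=> i /negbTE ->.
rewrite prodr_const; congr (_ ^+ _).
rewrite -Jk inordK//.
have E : (#|J| + #|[predC J]| = r)%N by rewrite cardC card_ord.
by rewrite -[X in (X - _)%N]E addKn.
Qed.

(** The coefficients of y^j in the two products are e_(t-j)(c) and e_(s-j)(d), so the chain, read
    from its right end, is the coefficient condition of [ratio_mono_of_coefs]. *)
Lemma ratio_chain_prod_mono (t s : nat) (c : 'I_t -> R) (d : 'I_s -> R) (y z : R) :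
  (s <= t)%N -> (forall i, 0 <= c i) -> (forall j, 0 <= d j) ->
  ratio_chain c d -> 0 <= y -> y <= z ->
  (\prod_(i < t) (c i + y)) * (\prod_(j < s) (d j + z)) <=
  (\prod_(i < t) (c i + z)) * (\prod_(j < s) (d j + y)).
Proof.
move=> st c0 d0 [dn0 chain] y0 yz.
(* The polynomial in d is padded with zero coefficients up to degree t; the condition for j > s then
   only needs e_k(c) and e_k(d) to be nonnegative. *)
pose r j : R := if (j <= s)%N then Defs.esym d (s - j) else 0.
have prodd w : \prod_(j < s) (d j + w) = \sum_(0 <= k < t.+1) r k * w ^+ k.
  rewrite prod_add_esym (big_cat_nat (n := s.+1) (p := t.+1))//=.
  rewrite [X in _ + X]big_nat [X in _ + X]big1 ?addr0; last first.
    by move=> i /andP[si _]; rewrite /r leqNgt si mul0r.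
  by rewrite !big_nat; apply: eq_bigr => i /andP[_ si]; rewrite /r -ltnS si.
rewrite !prodd !prod_add_esym; apply: ratio_mono_of_coefs => // i j /andP[ij jt].
rewrite /r; case: (leqP j s) => [js|sj]; last first.
  by rewrite mulr0 mulr_ge0//; [|case: ifP => //]; rewrite esym_ge0.
rewrite (leq_trans (ltnW ij) js).
have dpos k : (k <= s)%N -> 0 < Defs.esym d k.
  case: k => [|k] ks; first by rewrite esym0.
  by rewrite lt0r esym_ge0// andbT dn0.
have chain_le k l : (k + l <= s)%N ->
    Defs.esym c (t - s + (k + l)) / Defs.esym d (k + l)
      <= Defs.esym c (t - s + k) / Defs.esym d k.
  elim: l => [|l IH] kl; first by rewrite addn0.
  rewrite addnS in kl *; apply: le_trans (IH _); last exact: ltnW.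
  exact: chain.
have := chain_le (s - j)%N (j - i)%N.
have -> : (s - j + (j - i) = s - i)%N by lia.
have -> : (t - s + (s - i) = t - i)%N by lia.
have -> : (t - s + (s - j) = t - j)%N by lia.
move=> /(_ (leq_subr _ _)).
by rewrite ler_pdivrMr ?dpos ?leq_subr// mulrAC ler_pdivlMr// dpos// leq_subr.
Qed.

End ElementarySymmetric.

(** * The q-gamma function *)

Section QGammaRatio.
Context {R : realType}.
Variable q : R.
Hypotheses (q_gt0 : 0 < q) (q_lt1 : q < 1).

Lemma qpochS u n : qpoch u q n.+1 = qpoch u q n * (1 - u * q ^+ n).
Proof. by rewrite /qpoch big_nat_recr. Qed.

Lemma qpoch_recl u n : qpoch u q n.+1 = (1 - u) * qpoch (u * q) q n.
Proof.
rewrite /qpoch big_nat_recl//= expr0 mulr1; congr (_ * _).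
by apply: eq_bigr => k _; rewrite exprS mulrA.
Qed.

Lemma qpoch_factor u n : 0 <= u -> u < 1 -> 0 < 1 - u * q ^+ n <= 1.
Proof.
move=> u0 u1; have qn0 : 0 <= q ^+ n by rewrite exprn_ge0// ltW.
have qn1 : q ^+ n <= 1 by rewrite exprn_ile1// ltW.
have uq0 := mulr_ge0 u0 qn0; have : u * q ^+ n <= u by rewrite ler_piMr.
by move=> uqn; apply/andP; split; lra.
Qed.

Lemma qpoch_gt0 u n : 0 <= u -> u < 1 -> 0 < qpoch u q n.
Proof.
by move=> u0 u1; rewrite prodr_gt0// => k _; case/andP: (qpoch_factor u k u0 u1).
Qed.

Lemma qpoch_le1 u n : 0 <= u -> u < 1 -> qpoch u q n <= 1.
Proof.
move=> u0 u1; rewrite prodr_ile1// => k _.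
by case/andP: (qpoch_factor u k u0 u1) => /ltW -> ->.
Qed.

Lemma qpoch_nonincreasing u : 0 <= u -> u < 1 -> nonincreasing_seq (qpoch u q).
Proof.
move=> u0 u1; apply/nonincreasing_seqP => n.
case/andP: (qpoch_factor u n u0 u1) => _ le1.
by rewrite qpochS ler_piMr// ltW// qpoch_gt0.
Qed.

(* Every factor satisfies [1 - u q^k >= exp (- q^k / (1 - u))]. *)
Lemma qpoch_lower_bound u n : 0 <= u -> u < 1 ->
  expR (- ((1 - q)^-1 / (1 - u))) <= qpoch u q n.
Proof.
move=> u0 u1; have u1' : 0 < 1 - u by lra.
have q1' : 0 < 1 - q by rewrite subr_gt0.
(* The limit 1 / (1 - q) is replaced by the partial geometric sum, so that the induction on [n] can
   go factor by factor. *)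
apply: (@le_trans _ _ (expR (- ((\sum_(0 <= k < n) q ^+ k) / (1 - u))))).
  rewrite ler_expR lerN2 ler_pM2r ?invr_gt0//.
  rewrite -[leRHS]mul1r ler_pdivlMr// -/(series (fun k => q ^+ k) n).
  have -> : series (fun k => q ^+ k) n * (1 - q) = 1 - q ^+ n.
    by rewrite /series/= big_mkord mulrC -opprB mulNr -subrX1 opprB.
  by rewrite gerBl exprn_ge0// ltW.
elim: n => [|n IH]; first by rewrite /qpoch !big_geq// mul0r oppr0 expR0.
rewrite big_nat_recr//= mulrDl opprD expRD qpochS.
apply: ler_pM; rewrite ?expR_ge0//.
case/andP: (qpoch_factor u n u0 u1) => pos _.
have qn0 : 0 <= q ^+ n by rewrite exprn_ge0// ltW.
have qn1 : q ^+ n <= 1 by rewrite exprn_ile1// ltW.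
rewrite expRN -div1r ler_pdivrMr ?expR_gt0//.
apply: le_trans (ler_wpM2l (ltW pos) (expR_ge1Dx _)).
rewrite -subr_ge0.
have -> : (1 - u * q ^+ n) * (1 + q ^+ n / (1 - u)) - 1
    = q ^+ n * ((1 - u) ^+ 2 + u * (1 - q ^+ n)) / (1 - u) by field; lra.
apply: divr_ge0; last exact: ltW.
by rewrite mulr_ge0// addr_ge0 ?sqr_ge0// mulr_ge0// subr_ge0.
Qed.


Lemma qpoch_cvg u : 0 <= u -> u < 1 -> qpoch u q @ \oo --> qpoch_inf u q.
Proof.
move=> u0 u1; apply: nonincreasing_is_cvgn; first exact: qpoch_nonincreasing.
exists (expR (- ((1 - q)^-1 / (1 - u)))) => _ [n _ <-].
exact: qpoch_lower_bound.
Qed.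

(** Positivity of the partial products would not survive the limit; the exponential bound uniform in
    [n] does. *)
Lemma qpoch_inf_gt0 u : 0 <= u -> u < 1 -> 0 < qpoch_inf u q.
Proof.
move=> u0 u1; apply: lt_le_trans (expR_gt0 (- ((1 - q)^-1 / (1 - u)))) _.
by apply: limr_ge; [exact: qpoch_cvg|apply: nearW => n; exact: qpoch_lower_bound].
Qed.

Lemma qpoch_inf_le u n : 0 <= u -> u < 1 -> qpoch_inf u q <= qpoch u q n.
Proof.
move=> u0 u1; apply: nonincreasing_cvgn_ge; last exact: qpoch_cvg.
exact: qpoch_nonincreasing.
Qed.

Lemma qpoch_inf_rec u : 0 <= u -> u < 1 ->
  qpoch_inf u q = (1 - u) * qpoch_inf (u * q) q.
Proof.
move=> u0 u1; have uq0 : 0 <= u * q by rewrite mulr_ge0// ltW.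
have uq1 : u * q < 1 by rewrite (le_lt_trans _ u1)// ler_piMr// ltW.
have shift : (fun n => qpoch u q n.+1) @ \oo --> qpoch_inf u q.
  by rewrite cvg_shiftS; exact: qpoch_cvg.
rewrite -(cvg_lim _ shift)//; apply: cvg_lim => //.
have -> : (fun n => qpoch u q n.+1) = (fun n => (1 - u) * qpoch (u * q) q n).
  by apply/funext => n; rewrite qpoch_recl.
by apply: cvgMl_tmp; exact: qpoch_cvg.
Qed.

Lemma qpow_lt1 z : 0 < z -> q `^ z < 1.
Proof.
by move=> z0; rewrite /powR gt_eqF// expR_lt1 pmulr_rlt0// ln_lt0// q_gt0.
Qed.

Lemma qGamma_gt0 z : 0 < z -> 0 < qGamma q z.
Proof.
move=> z0; rewrite /qGamma mulr_gt0 ?powR_gt0 ?subr_gt0//.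
by rewrite divr_gt0// qpoch_inf_gt0 ?powR_ge0 ?qpow_lt1// ltW.
Qed.

Lemma qGammaS z : 0 < z -> qGamma q (z + 1) = (1 - q `^ z) / (1 - q) * qGamma q z.
Proof.
move=> z0; have q1' : 0 < 1 - q by rewrite subr_gt0.
have qz0 := powR_ge0 q z; have qz1 := qpow_lt1 z z0.
rewrite /qGamma.
have -> : q `^ (z + 1) = q `^ z * q.
  by rewrite powRD ?(gt_eqF q_gt0) ?implybT// powRr1// ltW.
have -> : (1 - q) `^ (1 - (z + 1)) = (1 - q) `^ (1 - z) / (1 - q).
  by rewrite opprD addrA powRB ?(gt_eqF q1') ?implybT// powRr1// ltW.
rewrite (qpoch_inf_rec _ qz0 qz1).
have : qpoch_inf (q `^ z * q) q != 0.
  rewrite gt_eqF// qpoch_inf_gt0 ?mulr_ge0 ?(ltW q_gt0)//.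
  by rewrite (le_lt_trans _ qz1)// ler_piMr// ltW.
move=> ne0; field; rewrite ne0 /=; apply/andP; split; rewrite gt_eqF//; lra.
Qed.

Lemma qGammaDn z n : 0 < z ->
  qGamma q (z + n%:R) = qpoch (q `^ z) q n / (1 - q) ^+ n * qGamma q z.
Proof.
move=> z0; have q1' : 0 < 1 - q by rewrite subr_gt0.
elim: n => [|n IH]; first by rewrite addr0 /qpoch big_geq// expr0 divr1 mul1r.
have zn0 : 0 < z + n%:R by rewrite ltr_wpDr.
rewrite -natr1 addrA (qGammaS _ zn0) IH qpochS exprS.
rewrite powRD ?(gt_eqF q_gt0) ?implybT// powR_mulrn ?ltW//.
by field; rewrite expf_neq0 gt_eqF.
Qed.

End QGammaRatio.

(** * The generalized Turanian *)

Section GammaRatioSeries.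
Context {R : realType}.
Variable q : R.
Hypotheses (q_gt0 : 0 < q) (q_lt1 : q < 1).

Let q_ge0 : 0 <= q := ltW q_gt0.
Let q1_gt0 : 0 < 1 - q. Proof. by rewrite subr_gt0. Qed.
Let qpochq_gt0 n : 0 < qpoch q q n. Proof. exact: qpoch_gt0. Qed.

Definition gratio {t s : nat} (a : 'I_t -> R) (b : 'I_s -> R) v : R :=
  (\prod_(i < t) qGamma q (a i + v)) / \prod_(j < s) qGamma q (b j + v).

(** The weights h of the expansion. Of the power (1 - q)^(pn) in the series only (1 - q)^n appears
    here, because the exponent n (s - t) is absorbed in the shifted gamma ratio. *)
Definition hcoef (p n : nat) : R :=
  (q ^+ 'C(n, 2)) ^+ p * (1 - q) ^+ n / qpoch q q n.

Definition gcoef {t s : nat} (a : 'I_t -> R) (b : 'I_s -> R) v n : R :=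
  gratio a b (v + n%:R) * hcoef (1 + s - t) n.

Lemma hcoef_gt0 p n : 0 < hcoef p n.
Proof. by rewrite divr_gt0// mulr_gt0// ?exprn_gt0. Qed.

Lemma hcoefS p n :
  hcoef p n.+1 = hcoef p n * ((q ^+ n) ^+ p * (1 - q) / (1 - q ^+ n.+1)).
Proof.
have e : 1 - q ^+ n.+1 != 0.
  by rewrite gt_eqF// subr_gt0 exprn_ilt1.
have Q0 : qpoch q q n != 0 by rewrite gt_eqF.
rewrite /hcoef qpochS -exprS binS bin1 exprD exprMn exprSr.
by field; rewrite e Q0.
Qed.

(** The ratio h_(n+1) / h_n = q^(np) (1 - q) / (1 - q^(n+1)) is nonincreasing in n. *)
Lemma hcoef_logconcave p i j : (i <= j)%N ->
  hcoef p i * hcoef p j.+1 <= hcoef p i.+1 * hcoef p j.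
Proof.
move=> ij; rewrite !hcoefS mulrA [leRHS]mulrAC ler_wpM2l//.
  by rewrite mulr_ge0// ltW// hcoef_gt0.
have den n : 0 < 1 - q ^+ n.+1 by rewrite subr_gt0 exprn_ilt1.
have qij : q ^+ j <= q ^+ i by rewrite ler_wiXn2l// ltW.
have num : (q ^+ j) ^+ p <= (q ^+ i) ^+ p by rewrite lerXn2r// nnegrE exprn_ge0.
apply: ler_pM; rewrite ?invr_ge0 ?mulr_ge0 ?exprn_ge0 ?(ltW q1_gt0) ?(ltW (den _))//.
  by rewrite ler_pM2r.
by rewrite lef_pV2 ?posrE// lerD2l lerN2 ler_wiXn2l// ltW.
Qed.

(** The sequence T_n = q^C(n,2) (2y)^n has successive ratios 2 y q^n, at most 1 from some N on.
    Hence it is bounded by T_0 + ... + T_N, a crude substitute for its maximum. *)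
Lemma expr_bin2_le_geometric (y : R) : 0 <= y ->
  exists K : R, forall n, q ^+ 'C(n, 2) * y ^+ n <= K * 2^-1 ^+ n.
Proof.
move=> y0.
have [N qNy] : exists N, q ^+ N * y <= 2^-1.
  have : (fun n => q ^+ n) @ \oo --> (0 : R).
    by apply: cvg_expr; rewrite ger0_norm.
  move=> /cvgr0_norm_lt /(_ (2^-1 / (y + 1))).
  rewrite divr_gt0 ?ltr_wpDl// => /(_ isT)[N _ /(_ N (leqnn _))].
  rewrite ger0_norm ?exprn_ge0// ltr_pdivlMr ?ltr_wpDl// => H.
  by exists N; apply: le_trans (ltW H); rewrite ler_wpM2l ?exprn_ge0// lerDl.
pose T n := q ^+ 'C(n, 2) * (y * 2) ^+ n.
have T0 n : 0 <= T n by rewrite mulr_ge0 ?exprn_ge0// mulr_ge0.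
exists (\sum_(0 <= k < N.+1) T k) => n.
rewrite exprVn ler_pdivlMr ?exprn_gt0// -mulrA -exprMn -/(T n).
elim: n => [|n IH].
  by rewrite big_nat_recl//= lerDl sumr_ge0.
case: (ltnP n N) => nN.
  rewrite (bigD1_seq n.+1) ?iota_uniq ?mem_index_iota//=.
  by rewrite lerDl sumr_ge0.
apply: le_trans IH; rewrite /T binS bin1 exprD exprSr.
set A := q ^+ 'C(n, 2); set B := (y * 2) ^+ n.
have -> : A * q ^+ n * (B * (y * 2)) = A * B * (q ^+ n * y * 2) by ring.
rewrite ler_piMr//; first by rewrite /A /B; exact: T0.
rewrite -ler_pdivlMr// div1r; apply: le_trans qNy.
by rewrite ler_wpM2r// ler_wiXn2l// ltW.
Qed.

(** * The power series of g at a fixed parameter v *)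

Section Shifted.
Variables (t s : nat) (a : 'I_t -> R) (b : 'I_s -> R) (v : R).
Hypotheses (av_gt0 : forall i, 0 < a i + v) (bv_gt0 : forall j, 0 < b j + v).

Let Pa n := \prod_(i < t) qpoch (q `^ (a i + v)) q n.
Let Pb n := \prod_(j < s) qpoch (q `^ (b j + v)) q n.

Lemma gratio_gt0 : 0 < gratio a b v.
Proof. by rewrite divr_gt0// prodr_gt0// => i _; exact: qGamma_gt0. Qed.

Let Pb_gt0 n : 0 < Pb n.
Proof. by rewrite prodr_gt0// => i _; rewrite qpoch_gt0 ?powR_ge0// qpow_lt1. Qed.

Lemma gratioDn n : gratio a b (v + n%:R) =
  gratio a b v * (Pa n / Pb n) * (((1 - q) ^+ n) ^+ s / ((1 - q) ^+ n) ^+ t).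
Proof.
have shift r (c : 'I_r -> R) : (forall i, 0 < c i + v) ->
    \prod_(i < r) qGamma q (c i + (v + n%:R)) =
    (\prod_(i < r) qpoch (q `^ (c i + v)) q n) / ((1 - q) ^+ n) ^+ r
      * \prod_(i < r) qGamma q (c i + v).
  move=> cv; rewrite -[X in _ / _ ^+ X]card_ord -prodr_const -prodf_div -big_split/=.
  by apply: eq_bigr => i _; rewrite addrA qGammaDn.
have rearrange (A B C D E F : R) :
  C * F * A * (D * E * B) = A * B * (C * D) * (E * F) by ring.
by rewrite /gratio (shift _ a)// (shift _ b)// !invfM invrK; exact: rearrange.
Qed.

Hypothesis ts1 : (t <= s + 1)%N.

Lemma gcoefE n : gcoef a b v n = gratio a b v *
  (Pa n / (Pb n * qpoch q q n) * (q ^+ 'C(n, 2) * (1 - q) ^+ n) ^+ (1 + s - t)).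
Proof.
rewrite /gcoef gratioDn /hcoef; set Z := (1 - q) ^+ n.
have Z0 : Z != 0 by rewrite expf_neq0// gt_eqF.
have e : Z ^+ s / Z ^+ t * Z = Z ^+ (1 + s - t).
  rewrite mulrAC -exprSr; apply: (canLR (mulfK _)); first exact: expf_neq0.
  by rewrite -exprD; congr (_ ^+ _); lia.
rewrite exprMn -e invfM.
by move: (Z ^+ s / Z ^+ t) (_ ^+ (1 + s - t)) => E F; ring.
Qed.

Lemma gcoef_gt0 n : 0 < gcoef a b v n.
Proof.
rewrite gcoefE; apply: mulr_gt0; first exact: gratio_gt0.
apply: mulr_gt0; last by rewrite exprn_gt0// mulr_gt0// exprn_gt0.
apply: divr_gt0; last exact: mulr_gt0.
apply: prodr_gt0 => i _.
by rewrite qpoch_gt0 ?powR_ge0// qpow_lt1.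
Qed.

(** The sign (-1)^(np) of the basic hypergeometric coefficient cancels the one hidden in (q -
    1)^(pn), which is why all [gcoef] are positive. *)
Lemma gcoef_term x n : gcoef a b v n * x ^+ n = gratio a b v *
  (qhyp_coef q (fun i => q `^ (a i + v)) (fun j => q `^ (b j + v)) n
    * ((q - 1) ^+ (1 + s - t) * x) ^+ n).
Proof.
rewrite gcoefE /qhyp_coef -/(Pa n) -/(Pb n) [(_ * x) ^+ n]exprMn.
have -> : ((q - 1) ^+ (1 + s - t)) ^+ n = ((-1) ^+ n * (1 - q) ^+ n) ^+ (1 + s - t).
  by rewrite -exprM mulnC exprM -exprMn mulN1r opprB.
rewrite !(exprMn (1 + s - t)).
have : ((-1) ^+ n) ^+ (1 + s - t) * ((-1) ^+ n) ^+ (1 + s - t) = 1 :> R.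
  by rewrite -exprMn -exprMn mulrNN mulr1 !expr1n.
set w := ((-1) ^+ n) ^+ _ => w2; rewrite -[LHS]mulr1 -w2; ring.
Qed.

(** Finite q-shifted factorials in the numerator are at most 1, and those in the denominator are at
    least their positive infinite products. *)
Lemma gcoef_bound : exists2 K : R, 0 <= K & forall n,
  gcoef a b v n <= K * (q ^+ 'C(n, 2) * (1 - q) ^+ n) ^+ (1 + s - t).
Proof.
pose L := (\prod_(j < s) qpoch_inf (q `^ (b j + v)) q) * qpoch_inf q q.
have L0 : 0 < L.
  rewrite mulr_gt0 ?qpoch_inf_gt0//; apply: prodr_gt0 => j _.
  by rewrite qpoch_inf_gt0 ?powR_ge0 ?qpow_lt1.
have g0 := ltW gratio_gt0.
exists (gratio a b v / L); first by rewrite divr_ge0// ltW.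
move=> n; rewrite gcoefE -[leRHS]mulrA ler_wpM2l// ler_wpM2r//.
  by rewrite exprn_ge0// mulr_ge0// exprn_ge0// ltW.
rewrite -[leRHS]mul1r; apply: ler_pM.
- by apply: prodr_ge0 => i _; rewrite ltW// qpoch_gt0 ?powR_ge0 ?qpow_lt1.
- by rewrite invr_ge0 mulr_ge0// ltW.
- rewrite prodr_ile1// => i _; rewrite qpoch_le1 ?powR_ge0 ?qpow_lt1// andbT.
  by rewrite ltW// qpoch_gt0 ?powR_ge0 ?qpow_lt1.
- have PQ0 : 0 < Pb n * qpoch q q n by exact: mulr_gt0.
  rewrite lef_pV2 ?posrE// /L /Pb; apply: ler_pM.
  + by apply: prodr_ge0 => i _; rewrite ltW// qpoch_inf_gt0 ?powR_ge0 ?qpow_lt1.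
  + by rewrite ltW// qpoch_inf_gt0.
  + apply: ler_prod => i _; rewrite qpoch_inf_le ?powR_ge0 ?qpow_lt1// andbT.
    by rewrite ltW// qpoch_inf_gt0 ?powR_ge0 ?qpow_lt1.
  + by rewrite qpoch_inf_le.
Qed.

Lemma gcoef_normed_cvg x : conv_domain t s x ->
  cvgn [normed series (fun n => gcoef a b v n * x ^+ n)].
Proof.
move=> Dx.
have [K [r [r0 r1 bound]]] : exists K r : R, [/\ 0 <= r, r < 1 &
    forall n, `|gcoef a b v n * x ^+ n| <= K * r ^+ n].
  have [K K0 gK] := gcoef_bound.
  have ng n : `|gcoef a b v n * x ^+ n| <=
      K * (q ^+ 'C(n, 2) * (1 - q) ^+ n) ^+ (1 + s - t) * `|x| ^+ n.
    rewrite normrM normrX ger0_norm ?(ltW (gcoef_gt0 n))//.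
    by rewrite ler_wpM2r ?exprn_ge0.
  (* If p = 0 then t = s + 1, the domain gives |x| < 1, and |x| is the geometric ratio. If p > 0,
     one factor q^C(n,2) already beats |x|^n and gives ratio 1/2. *)
  have [p0|p0] := posnP (1 + s - t)%N.
    exists K, `|x|; split => //; first by case: Dx => //; lia.
    by move=> n; have := ng n; rewrite p0 expr0 mulr1.
  have [C HC] := expr_bin2_le_geometric _ (normr_ge0 x).
  exists (K * C), 2^-1; split; rewrite ?invr_ge0 ?invf_lt1 ?ltr1n// => n.
  apply: le_trans (ng n) _; rewrite -!mulrA ler_wpM2l//.
  apply: le_trans (HC n); rewrite ler_wpM2r ?exprn_ge0//.
  have b0 : 0 <= q ^+ 'C(n, 2) * (1 - q) ^+ n.
    by rewrite mulr_ge0 ?exprn_ge0// ltW.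
  have b1 : q ^+ 'C(n, 2) * (1 - q) ^+ n <= q ^+ 'C(n, 2).
    by rewrite ler_piMr ?exprn_ge0// exprn_ile1 ?(ltW q1_gt0)// gerBl.
  apply: le_trans b1; rewrite -(prednK p0) exprS ler_piMr// exprn_ile1//.
  rewrite -[leRHS]mulr1; apply: ler_pM; rewrite ?exprn_ge0 ?exprn_ile1 ?(ltW q1_gt0)//.
    exact: ltW.
  by rewrite gerBl.
apply: (@series_le_cvg _ _ (fun n => K * r ^+ n)) => [n|n|n|]; first exact: normr_ge0.
- exact: le_trans (bound n).
- exact: bound.
- by apply: is_cvg_geometric_series; rewrite ger0_norm.
Qed.

Lemma gfun_cvg x : conv_domain t s x ->
  pseries (gcoef a b v) x @ \oo --> gfun q a b v x.
Proof.
move=> Dx; have cv := normed_cvg (gcoef_normed_cvg _ Dx).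
pose u n := qhyp_coef q (fun i => q `^ (a i + v)) (fun j => q `^ (b j + v)) n
    * ((q - 1) ^+ (1 + s - t) * x) ^+ n.
have E : pseries (gcoef a b v) x = fun N => gratio a b v * series u N.
  apply/funext => N; rewrite /pseries /series /= mulr_sumr.
  by apply: eq_bigr => n _; exact: gcoef_term.
(* Dividing by the nonzero gamma ratio shows that the hypergeometric series converges, so that
   [limn] in [qhyp] is its true sum and not a default value. *)
have cu : cvgn (series u).
  have /gt_eqF g0 := gratio_gt0.
  have -> : series u = fun N => (gratio a b v)^-1 * pseries (gcoef a b v) x N.
    by apply/funext => N; rewrite E mulKf// g0.
  exact: is_cvgMl_tmp.
by rewrite E; apply: cvgMl_tmp.
Qed.

Lemma gfun_gt0 x : 0 <= x -> conv_domain t s x -> 0 < gfun q a b v x.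
Proof.
move=> x0 Dx; apply: lt_le_trans (gcoef_gt0 0) _.
apply: (cvgr_to_ge (gfun_cvg _ Dx)); exists 1%N => //= N /= N1.
rewrite /pseries /series /= big_ltn// expr0 mulr1 lerDl sumr_ge0// => n _.
by rewrite mulr_ge0 ?exprn_ge0// ltW// gcoef_gt0.
Qed.

End Shifted.

(** * Signs of the Turanian and of its coefficients *)

Section TuranianSign.
Variables (t s : nat) (a : 'I_t -> R) (b : 'I_s -> R) (mu : R).
Hypotheses (amu_gt0 : forall i, 0 < a i + mu) (bmu_gt0 : forall j, 0 < b j + mu).

Let av_gt0 v : mu <= v -> forall i, 0 < a i + v.
Proof. by move=> muv i; rewrite (lt_le_trans (amu_gt0 i))// lerD2l. Qed.

Let bv_gt0 v : mu <= v -> forall j, 0 < b j + v.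
Proof. by move=> muv j; rewrite (lt_le_trans (bmu_gt0 j))// lerD2l. Qed.

Definition shift_prod {r : nat} (c : 'I_r -> R) (y : R) :=
  \prod_(i < r) (qshift q c i + y).

Lemma one_sub_qpow (c v : R) :
  1 - q `^ (c + v) = q `^ c * (q `^ (- c) - 1 + (1 - q `^ v)).
Proof.
have qc : q `^ c != 0 by rewrite gt_eqF ?powR_gt0.
by rewrite powRD ?(gt_eqF q_gt0) ?implybT// powRN; field.
Qed.

Lemma prod_qpoch1 r (c : 'I_r -> R) v : \prod_(i < r) qpoch (q `^ (c i + v)) q 1 =
  (\prod_(i < r) q `^ (c i)) * shift_prod c (1 - q `^ v).
Proof.
rewrite -big_split; apply: eq_bigr => i _.
by rewrite /qpoch big_nat1 expr0 mulr1 one_sub_qpow.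
Qed.

Let kappa := (\prod_(i < t) q `^ (a i)) / (\prod_(j < s) q `^ (b j))
  * ((1 - q) ^+ s / (1 - q) ^+ t).

Let kappa_gt0 : 0 < kappa.
Proof.
by rewrite mulr_gt0 ?divr_gt0 ?exprn_gt0 ?prodr_gt0// => i _; rewrite powR_gt0.
Qed.

Lemma gratioS v : mu <= v -> gratio a b (v + 1) = gratio a b v * kappa *
  (shift_prod a (1 - q `^ v) / shift_prod b (1 - q `^ v)).
Proof.
move=> muv; have := gratioDn _ _ _ _ _ (av_gt0 _ muv) (bv_gt0 _ muv) 1.
rewrite expr1 !prod_qpoch1 => ->; rewrite /kappa -mulf_div; ring.
Qed.

Lemma shift_prod_gt0 r (c : 'I_r -> R) v :
  (forall i, 0 < c i + v) -> 0 < shift_prod c (1 - q `^ v).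
Proof.
move=> cv; apply: prodr_gt0 => i _.
have : 0 < 1 - q `^ (c i + v) by rewrite subr_gt0 qpow_lt1.
by rewrite one_sub_qpow pmulr_rgt0 ?powR_gt0.
Qed.

Variable eps : R.
Hypothesis shift_prod_mono : forall y z, 0 <= y -> y <= z ->
  0 <= eps * (shift_prod a y * shift_prod b z - shift_prod a z * shift_prod b y).
Hypotheses (mu_ge0 : 0 <= mu) (ts1 : (t <= s + 1)%N).

(** As y = 1 - q^v is nonnegative and nondecreasing in v >= 0, the one-step inequality compares the
    quotient of the two shifted products at v and v + beta, after positive factors are cleared;
    [turan_shift_nat] then reaches all natural shifts. *)
Lemma gratio_turan (n : nat) v beta : mu <= v -> 0 <= beta ->
  0 <= eps * (gratio a b (v + n%:R) * gratio a b (v + beta)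
              - gratio a b v * gratio a b (v + n%:R + beta)).
Proof.
apply: turan_shift_nat => {n v beta} [v muv|v beta muv beta0].
  by apply: gratio_gt0; [exact: av_gt0|exact: bv_gt0].
have muvb : mu <= v + beta by rewrite ler_wpDr.
rewrite addrAC !gratioS//; set y := 1 - q `^ v; set z := 1 - q `^ (v + beta).
have q01 : 0 < q <= 1 by rewrite q_gt0 ltW.
have y0 : 0 <= y.
  by rewrite subr_ge0 -[leRHS](powRr0 q); apply: ger_powR => //; exact: le_trans muv.
have yz : y <= z by rewrite lerD2l lerN2; apply: ger_powR => //; rewrite lerDl.
have Qy : 0 < shift_prod b y by apply: shift_prod_gt0; exact: bv_gt0.
have Qz : 0 < shift_prod b z by apply: shift_prod_gt0; exact: bv_gt0.
have gv : 0 < gratio a b v by apply: gratio_gt0; [exact: av_gt0|exact: bv_gt0].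
have gvb : 0 < gratio a b (v + beta).
  by apply: gratio_gt0; [exact: av_gt0|exact: bv_gt0].
have alg (g g' k P Q P' Q' : R) : 0 < g -> 0 < g' -> 0 < k -> 0 < Q -> 0 < Q' ->
    0 <= eps * (P * Q' - P' * Q) ->
    0 <= eps * (g * k * (P / Q) * g' - g * (g' * k * (P' / Q'))).
  move=> g0 g'0 k0 Q0 Q'0 H.
  have -> : eps * (g * k * (P / Q) * g' - g * (g' * k * (P' / Q'))) =
      g * g' * k / (Q * Q') * (eps * (P * Q' - P' * Q)).
    by field; rewrite !gt_eqF.
  by rewrite mulr_ge0// divr_ge0 ?mulr_ge0// ltW.
by apply: alg => //; exact: shift_prod_mono.
Qed.

Definition turan_coef (alpha beta : R) m : R :=
  cauchy_prod (gcoef a b (mu + alpha)) (gcoef a b (mu + beta)) m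
  - cauchy_prod (gcoef a b mu) (gcoef a b (mu + alpha + beta)) m.

Lemma turan_coef_expands alpha beta : 0 <= alpha -> 0 <= beta ->
  expands_on (conv_domain t s) (turanian q a b mu alpha beta)
    (turan_coef alpha beta).
Proof.
move=> alpha0 beta0 x Dx.
have prod_cvg v w : mu <= v -> mu <= w ->
    pseries (cauchy_prod (gcoef a b v) (gcoef a b w)) x @ \oo -->
    gfun q a b v x * gfun q a b w x.
  move=> muv muw.
  have gv := gfun_cvg _ _ _ _ _ (av_gt0 _ muv) (bv_gt0 _ muv) ts1 _ Dx.
  have gw := gfun_cvg _ _ _ _ _ (av_gt0 _ muw) (bv_gt0 _ muw) ts1 _ Dx.
  rewrite -(cvg_lim _ gv)// -(cvg_lim _ gw)// pseries_cauchy_prod.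
  apply: cauchy_prod_cvg.
    exact: gcoef_normed_cvg (av_gt0 _ muv) (bv_gt0 _ muv) ts1 _ Dx.
  exact: gcoef_normed_cvg (av_gt0 _ muw) (bv_gt0 _ muw) ts1 _ Dx.
rewrite [pseries _ _](_ : _ =
  pseries (cauchy_prod (gcoef a b (mu + alpha)) (gcoef a b (mu + beta))) x
  - pseries (cauchy_prod (gcoef a b mu) (gcoef a b (mu + alpha + beta))) x).
  by apply: cvgB; apply: prod_cvg => //; rewrite ?ler_wpDr.
apply/funext => n; rewrite fctE /pseries /series /= -sumrB.
by apply: eq_bigr => k _; rewrite mulrBl.
Qed.

Lemma turan_coef_sign (alpha : nat) beta m : 0 <= beta -> alpha%:R <= beta + 1 ->
  0 <= eps * turan_coef alpha%:R beta m.
Proof.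
move=> beta0 alpha_le; rewrite /turan_coef /cauchy_prod -sumrB.
apply: turan_coef_ge0 => //; first exact: gratio_turan.
  by move=> n; rewrite ltW// hcoef_gt0.
exact: hcoef_logconcave.
Qed.

End TuranianSign.

(** No bound on alpha is assumed: the shift 1 satisfies 1 <= beta + 1, so its coefficients, and
    hence its values at x >= 0, have the right sign at every v >= mu. Larger shifts follow by
    applying [turan_shift_nat] to v -> g(v; x). *)
Lemma turanian_sign (t s : nat) (a : 'I_t -> R) (b : 'I_s -> R) (mu eps : R) :
  (forall i, 0 < a i + mu) -> (forall j, 0 < b j + mu) ->
  (forall y z, 0 <= y -> y <= z ->
    0 <= eps * (shift_prod a y * shift_prod b z - shift_prod a z * shift_prod b y)) ->
  0 <= mu -> (t <= s + 1)%N ->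
  forall (alpha : nat) (beta x : R), 0 <= beta -> 0 <= x -> conv_domain t s x ->
  0 <= eps * turanian q a b mu alpha%:R beta x.
Proof.
move=> amu bmu mono mu0 ts1 alpha beta x beta0 x0 Dx.
have av v : mu <= v -> forall i, 0 < a i + v.
  by move=> muv i; rewrite (lt_le_trans (amu i))// lerD2l.
have bv v : mu <= v -> forall j, 0 < b j + v.
  by move=> muv j; rewrite (lt_le_trans (bmu j))// lerD2l.
apply: (@turan_shift_nat _ eps (fun v => gfun q a b v x) mu) => //.
  by move=> v muv; apply: gfun_gt0 => //; [exact: av|exact: bv].
move=> v {}beta muv {}beta0.
have expd := turan_coef_expands _ _ _ _ _ (av v muv) (bv v muv) ts1 _ _
  (@ler01 R) beta0 x Dx.
have lim : (fun N => eps * pseries (turan_coef _ _ a b v 1 beta) x N) @ \oo -->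
    eps * turanian q a b v 1 beta x by exact: cvgMl_tmp.
apply: (cvgr_to_ge lim); apply: nearW => N.
rewrite /pseries /series /= mulr_sumr sumr_ge0// => m _.
rewrite mulrA mulr_ge0 ?exprn_ge0//.
have v0 : 0 <= v := le_trans mu0 muv.
apply: (turan_coef_sign _ _ _ _ _ (av v muv) (bv v muv) _ mono v0 1%N) => //.
by rewrite lerDr.
Qed.

End GammaRatioSeries.

(** * Both signs at once, and the two parts of the theorem *)

Lemma qshift_ge0 (R : realType) (q : R) (r : nat) (a : 'I_r -> R) :
  0 < q -> q < 1 -> (forall i, 0 <= a i) -> forall i, 0 <= qshift q a i.
Proof.
move=> q0 q1 a0 i; rewrite /qshift subr_ge0 -[leLHS](powRr0 q).
by apply: ger_powR; [rewrite q0 ltW | rewrite oppr_le0].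
Qed.

(** The sign [eps] is a parameter so that (a) is the case -1 and (b) the case 1 of a single
    statement. *)
Lemma turanian_sign_and_coefs (R : realType) (q : R) (t s : nat)
    (a : 'I_t -> R) (b : 'I_s -> R) (mu eps : R) :
  0 < q -> q < 1 ->
  (forall i, 0 < a i + mu) -> (forall j, 0 < b j + mu) -> 0 <= mu ->
  (t <= s + 1)%N ->
  (forall y z, 0 <= y -> y <= z -> 0 <= eps *
    (shift_prod q a y * shift_prod q b z - shift_prod q a z * shift_prod q b y)) ->
  [/\ forall (alpha : nat) (beta x : R), 0 <= beta -> 0 <= x -> conv_domain t s x ->
         0 <= eps * turanian q a b mu alpha%:R beta x,
      forall (alpha : nat) (beta : R), 0 <= beta -> alpha%:R <= beta + 1 ->
         (exists gamma : nat -> R,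
            expands_on (conv_domain t s)
              (turanian q a b mu alpha%:R beta) gamma) /\
         (forall gamma : nat -> R,
            expands_on (conv_domain t s)
              (turanian q a b mu alpha%:R beta) gamma ->
            forall m, 0 <= eps * gamma m)
    & forall x : R, 0 < x -> conv_domain t s x ->
        0 <= eps * (gfun q a b (mu + 1) x ^+ 2
                    - gfun q a b mu x * gfun q a b (mu + 2) x)].
Proof.
move=> q0 q1 amu bmu mu0 ts1 mono.
have sgn := turanian_sign _ q0 q1 _ _ _ _ _ _ amu bmu mono mu0 ts1.
split=> // [alpha beta beta0 alpha_le|x x0 Dx].
  have E := turan_coef_expands _ q0 q1 _ _ _ _ _ amu bmu ts1 _ _
    (ler0n R alpha) beta0.
  split=> [|gamma G m]; first by eexists; exact: E.
  rewrite (expands_on_unique _ _ _ _ _ G E m).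
    exact: turan_coef_sign.
  move=> x x0 x1; right; rewrite ger0_norm//; exact: ltW.
(* The squared inequality is the case alpha = beta = 1. *)
have -> : mu + 2 = mu + 1 + 1 by rewrite -addrA.
by rewrite expr2; exact: (sgn 1%N 1 x ler01 (ltW x0) Dx).
Qed.

Theorem theorem1 (R : realType) (q : R) (t s : nat)
    (a : 'I_t -> R) (b : 'I_s -> R) (mu : R)
    (q_gt0 : 0 < q) (q_lt1 : q < 1)
    (a_ge0 : forall i, 0 <= a i) (b_ge0 : forall j, 0 <= b j)
    (mu_ge0 : 0 <= mu)
    (mu_gt0 : (exists i, a i = 0) \/ (exists j, b j = 0) -> 0 < mu) :
  ((s <= t <= s + 1)%N ->
   ratio_chain (qshift q a) (qshift q b) ->
   [/\ forall (alpha : nat) (beta x : R),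
         (1 <= alpha)%N -> 0 <= beta -> 0 <= x -> conv_domain t s x ->
         turanian q a b mu alpha%:R beta x <= 0,
       forall (alpha : nat) (beta : R),
         (1 <= alpha)%N -> 0 <= beta -> alpha%:R <= beta + 1 ->
         (exists gamma : nat -> R,
            expands_on (conv_domain t s)
              (turanian q a b mu alpha%:R beta) gamma) /\
         (forall gamma : nat -> R,
            expands_on (conv_domain t s)
              (turanian q a b mu alpha%:R beta) gamma ->
            forall m, gamma m <= 0)
     & forall x : R, 0 < x -> conv_domain t s x ->
         gfun q a b (mu + 1) x ^+ 2
         <= gfun q a b mu x * gfun q a b (mu + 2) x])
  /\
  ((t <= s)%N ->
   ratio_chain (qshift q b) (qshift q a) ->
   [/\ forall (alpha : nat) (beta x : R),
         (1 <= alpha)%N -> 0 <= beta -> 0 <= x ->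
         0 <= turanian q a b mu alpha%:R beta x,
       forall (alpha : nat) (beta : R),
         (1 <= alpha)%N -> 0 <= beta -> alpha%:R <= beta + 1 ->
         (exists gamma : nat -> R,
            expands_on (conv_domain t s)
              (turanian q a b mu alpha%:R beta) gamma) /\
         (forall gamma : nat -> R,
            expands_on (conv_domain t s)
              (turanian q a b mu alpha%:R beta) gamma ->
            forall m, 0 <= gamma m)
     & forall x : R, 0 < x ->
         gfun q a b mu x * gfun q a b (mu + 2) x
         <= gfun q a b (mu + 1) x ^+ 2]).

Proof.
have amu i : 0 < a i + mu.
  have := a_ge0 i; rewrite le_eqVlt => /predU1P[ai0|ai]; last exact: ltr_wpDr.
  by rewrite -ai0 add0r mu_gt0//; left; exists i.
have bmu j : 0 < b j + mu.
  have := b_ge0 j; rewrite le_eqVlt => /predU1P[bj0|bj]; last exact: ltr_wpDr.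
  by rewrite -bj0 add0r mu_gt0//; right; exists j.
have c_ge0 := qshift_ge0 _ _ _ _ q_gt0 q_lt1 a_ge0.
have d_ge0 := qshift_ge0 _ _ _ _ q_gt0 q_lt1 b_ge0.
split=> [/andP[st ts1] chain|ts chain].
  have mono y z : 0 <= y -> y <= z -> 0 <= -1 *
      (shift_prod q a y * shift_prod q b z - shift_prod q a z * shift_prod q b y).
    by move=> y0 yz; rewrite mulN1r opprB subr_ge0; exact: ratio_chain_prod_mono.
  have [sgn coefs sq] :=
    turanian_sign_and_coefs _ _ _ _ _ _ _ _ q_gt0 q_lt1 amu bmu mu_ge0 ts1 mono.
  split=> [alpha beta x _ beta0 x0 Dx|alpha beta _ beta0 alpha_le|x x0 Dx].
  - by rewrite -oppr_ge0 -mulN1r sgn.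
  - have [ex sg] := coefs alpha beta beta0 alpha_le; split=> // gamma G m.
    by rewrite -oppr_ge0 -mulN1r sg.
  - by rewrite -subr_ge0 -opprB -mulN1r sq.
(* In (b) the chain has c and d exchanged, so the monotonicity lemma applies after commuting the
   products. *)
have mono y z : 0 <= y -> y <= z -> 0 <= 1 *
    (shift_prod q a y * shift_prod q b z - shift_prod q a z * shift_prod q b y).
  move=> y0 yz; rewrite mul1r subr_ge0 mulrC [leRHS]mulrC.
  exact: ratio_chain_prod_mono.
have ts1 : (t <= s + 1)%N by rewrite addn1 leqW.
have [sgn coefs sq] :=
  turanian_sign_and_coefs _ _ _ _ _ _ _ _ q_gt0 q_lt1 amu bmu mu_ge0 ts1 mono.
(* Since t <= s, every real x lies in [conv_domain]. *)
split=> [alpha beta x _ beta0 x0|alpha beta _ beta0 alpha_le|x x0].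
- by rewrite -[leRHS]mul1r sgn//; left.
- have [ex sg] := coefs alpha beta beta0 alpha_le; split=> // gamma G m.
  by rewrite -[leRHS]mul1r sg.
- by rewrite -subr_ge0 -[leRHS]mul1r sq//; left.
Qed.
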